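(* Let $V$ be a finite dimensional $A$-vector space, where $A=\mathbf{k}((t))$, and let $M\subseteq V$ be an $\mathcal{O}$-submodule, where $\mathcal{O}=\mathbf{k}[[t]]$. If $\widetilde{M}=\{0\}$, then $M$ is a finitely generated $\mathcal{O}$-submodule of $V$.
   Context: $\mathbf{k}$ is a field. For an $\mathcal{O}$-submodule $M$ of an $A$-vector space $V$, $\widetilde{M}=\{x\in M \mid Ax\subseteq M\}$; it is the set of all divisible elements of $M$ and is an $A$-subspace of $V$. *)

(* Defs.v *)
From HB Require Import structures.
From mathcomp Require Import all_boot all_order all_algebra.
From mathcomp Require Import zify.
From mathcomp Require Import boolp classical_sets cardinality fsbigop.

Set Implicit Arguments.
Unset Strict Implicit.
Unset Printing Implicit Defensive.

Import Order.TTheory GRing.Theory Num.Theory.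
Local Open Scope classical_set_scope.
Local Open Scope ring_scope.

(** [k((t))]: [Laurent f] is the series with coefficient [f n] at [t ^ n]. *)
Record laurent (k : fieldType) := Laurent {
  lcoef :> int -> k;
  lcoefP : exists N : int, forall n : int, n < N -> lcoef n = 0
}.

HB.instance Definition _ (k : fieldType) := gen_eqMixin (laurent k).
HB.instance Definition _ (k : fieldType) := gen_choiceMixin (laurent k).

Section LaurentField.
Variable k : fieldType.
Implicit Types (f g h : laurent k) (N M L m : int) (n : nat).

Lemma laurent_ext f g : (forall m, f m = g m) -> f = g.
Proof.
case: f g => [f Hf] [g Hg] /= /funext E; subst g.
by congr Laurent; exact: Prop_irrelevance.
Qed.

Lemma zero_subproof :
  exists N : int, forall m, m < N -> (fun=> 0 : k) m = 0.
Proof. by exists 0. Qed.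
Definition lzero := Laurent zero_subproof.

Lemma one_subproof :
  exists N : int, forall m, m < N -> (m == 0)%:R = 0 :> k.
Proof. by exists 0 => m m0; rewrite lt_eqF. Qed.
Definition lone := Laurent one_subproof.

Lemma opp_subproof f : exists N : int, forall m, m < N -> - f m = 0.
Proof.
by have [N HN] := lcoefP f; exists N => m mN; rewrite HN // oppr0.
Qed.
Definition lopp f := Laurent (opp_subproof f).

Lemma add_subproof f g : exists N : int, forall m, m < N -> f m + g m = 0.
Proof.
have [N HN] := lcoefP f; have [M HM] := lcoefP g.
exists (Num.min N M) => m; rewrite lt_min => /andP[mN mM].
by rewrite HN // HM // addr0.
Qed.
Definition ladd f g := Laurent (add_subproof f g).

(** Only finitely many terms of the sum are nonzero: see [convE]. *)
Definition conv f g m : k := \sum_(i \in [set: int]) f i * g (m - i).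

Lemma conv0 f g N M m : (forall i, i < N -> f i = 0) ->
  (forall i, i < M -> g i = 0) -> m < N + M -> conv f g m = 0.
Proof.
move=> fN gM mNM; apply: fsbig1 => i _.
have [iN|iN] := ltP i N; first by rewrite fN // mul0r.
by rewrite gM ?mulr0 //; lia.
Qed.

Lemma mul_subproof f g : exists N : int, forall m, m < N -> conv f g m = 0.
Proof.
have [N HN] := lcoefP f; have [M HM] := lcoefP g.
by exists (N + M) => m; exact: conv0.
Qed.
Definition lmul f g := Laurent (mul_subproof f g).

Lemma convE f g N M n : (forall i, i < N -> f i = 0) ->
  (forall i, i < M -> g i = 0) ->
  conv f g (N + M + n%:Z) = \sum_(i < n.+1) f (N + i%:Z) * g (M + (n - i)%N%:Z).
Proof.
move=> fN gM; rewrite /conv.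
rewrite (fsbigE [seq N + i%:Z | i <- iota 0 n.+1]) //.
- rewrite big_map -[iota _ _]/(index_iota 0 n.+1) big_mkord.
  apply: eq_big => [i|i _]; first by rewrite in_setT.
  by congr (_ * g _); have := ltn_ord i; lia.
- by rewrite map_inj_uniq ?iota_uniq // => i j; lia.
- move=> i _ iNr.
  have [iN|Ni] := ltP i N; first by rewrite fN // mul0r.
  rewrite gM ?mulr0 // ltNge; apply: contra iNr => Mi.
  apply/mapP; exists `|i - N|%N; last by lia.
  by rewrite mem_iota; lia.
Qed.

Let trunc f N n : {poly k} := \poly_(i < n) f (N + i%:Z).

Lemma conv_trunc f g N M n p : (forall i, i < N -> f i = 0) ->
  (forall i, i < M -> g i = 0) -> (n < p)%N ->
  conv f g (N + M + n%:Z) = (trunc f N p * trunc g M p)`_n.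
Proof.
move=> fN gM np; rewrite (convE n fN gM) coefM; apply: eq_bigr => i _.
by rewrite !coef_poly !ifT //; have := ltn_ord i; lia.
Qed.

Lemma laddA : associative ladd.
Proof. by move=> f g h; apply: laurent_ext => m /=; rewrite addrA. Qed.

Lemma laddC : commutative ladd.
Proof. by move=> f g; apply: laurent_ext => m /=; rewrite addrC. Qed.

Lemma ladd0 : left_id lzero ladd.
Proof. by move=> f; apply: laurent_ext => m /=; rewrite add0r. Qed.

Lemma laddN : left_inverse lzero lopp ladd.
Proof. by move=> f; apply: laurent_ext => m /=; rewrite addNr. Qed.

HB.instance Definition _ :=
  GRing.isZmodule.Build (laurent k) laddA laddC ladd0 laddN.

Lemma int_geP N m : N <= m -> exists n : nat, m = N + n%:Z.
Proof. by move=> Nm; exists `|m - N|%N; lia. Qed.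

Lemma lmulA : associative lmul.
Proof.
move=> f g h; have [N fN] := lcoefP f; have [M gM] := lcoefP g.
have [L hL] := lcoefP h.
have fgNM i : i < N + M -> lmul f g i = 0 by exact: conv0.
have ghML i : i < M + L -> lmul g h i = 0 by exact: conv0.
apply: laurent_ext => m /=.
have [mlt|] := ltP m (N + M + L).
  by rewrite (conv0 fgNM hL) // (conv0 fN ghML) // addrA.
move=> /int_geP[n ->]; rewrite (convE n fgNM hL) -(addrA N M L) (convE n fN ghML) /=.
transitivity ((trunc f N n.+1 * (trunc g M n.+1 * trunc h L n.+1))`_n).
  rewrite coefM; apply: eq_bigr => i _; have in1 := ltn_ord i.
  by rewrite coef_poly in1 (@conv_trunc g h M L _ n.+1) //; lia.
rewrite mulrA coefM; apply: eq_bigr => i _; have in1 := ltn_ord i.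
rewrite [(trunc h L _)`__]coef_poly ifT; last by lia.
by rewrite (@conv_trunc f g N M _ n.+1).
Qed.

Lemma lmulC : commutative lmul.
Proof.
move=> f g; have [N fN] := lcoefP f; have [M gM] := lcoefP g.
apply: laurent_ext => m /=; have [mlt|] := ltP m (N + M).
  by rewrite (conv0 fN gM) // (conv0 gM fN) // addrC.
move=> /int_geP[n ->]; rewrite (conv_trunc fN gM (ltnSn n)).
by rewrite [N + M]addrC (conv_trunc gM fN (ltnSn n)) mulrC.
Qed.

Lemma lmul1 : left_id lone lmul.
Proof.
move=> f; have [N fN] := lcoefP f.
have one0 i : i < 0 -> lone i = 0 by move=> i0 /=; rewrite lt_eqF.
apply: laurent_ext => m /=; have [mlt|] := ltP m N.
  by rewrite (conv0 one0 fN) ?add0r // fN.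
move=> /int_geP[n ->]; rewrite -[N in LHS]add0r (convE n one0 fN).
rewrite big_ord_recl big1 ?addr0 /= ?subn0 ?mul1r //.
by move=> i _; rewrite mul0r.
Qed.

Lemma lmulDl : left_distributive lmul ladd.
Proof.
move=> f g h; have [N fN] := lcoefP f; have [M gM] := lcoefP g.
have [L hL] := lcoefP h; pose K := Num.min N M.
have fK i : i < K -> f i = 0 by rewrite lt_min => /andP[/fN].
have gK i : i < K -> g i = 0 by rewrite lt_min => /andP[_ /gM].
have fgK i : i < K -> ladd f g i = 0 by move=> iK /=; rewrite fK ?gK ?addr0.
apply: laurent_ext => m /=; have [mlt|] := ltP m (K + L).
  by rewrite (conv0 fgK hL) // (conv0 fK hL) // (conv0 gK hL) // addr0.
move=> /int_geP[n ->]; rewrite (convE n fgK hL) (convE n fK hL) (convE n gK hL).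
by rewrite -big_split /=; apply: eq_bigr => i _; rewrite mulrDl.
Qed.

Lemma lone_neq0 : lone != lzero.
Proof. by apply/eqP => /(congr1 (fun f => f 0)) /eqP /=; rewrite oner_eq0. Qed.

HB.instance Definition _ := GRing.Zmodule_isComNzRing.Build (laurent k)
  lmulA lmulC lmul1 lmulDl lone_neq0.

Fixpoint inv_coefs (a : nat -> k) n : seq k :=
  if n is p.+1 then
    let s := inv_coefs a p in
    rcons s ((a 0%N)^-1 * ((p == 0%N)%:R - \sum_(j < p) s`_j * a (p - j)%N))
  else [::].

Lemma inv_coefs_sum (a : nat -> k) n : a 0%N != 0 ->
  \sum_(j < n.+1) (inv_coefs a j.+1)`_j * a (n - j)%N = (n == 0%N)%:R.
Proof.
move=> a0; have sz p : size (inv_coefs a p) = p.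
  by elim: p => //= p IH; rewrite size_rcons IH.
have stable j p : (j < p)%N -> (inv_coefs a p)`_j = (inv_coefs a j.+1)`_j.
  elim: p => // p IH; rewrite ltnS leq_eqVlt => /predU1P[-> //|jp].
  by rewrite -IH //= nth_rcons sz jp.
rewrite big_ord_recr /= subnn nth_rcons sz ltnn eqxx mulrAC mulVf // mul1r.
rewrite addrC -[RHS]subr0 -addrA; congr (_ + _); apply/eqP.
rewrite oppr0 addrC subr_eq0; apply/eqP/eq_bigr => j _.
by rewrite (stable j n).
Qed.

Lemma lmul_inv_ex f : f != 0 -> exists g, g * f = 1.
Proof.
move=> f0; have [N0 fN0] := lcoefP f.
have exn : exists n : nat, f (N0 + n%:Z) != 0.
  apply: contrapT => H; move/eqP: f0; apply; apply: laurent_ext => m /=.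
  have [/fN0 //|/int_geP[n ->]] := ltP m N0.
  by apply: contrapT => fm; apply: H; exists n; apply/eqP.
have [n fn nmin] := ex_minnP exn; set N : int := N0 + n%:Z in fn.
have fN i : i < N -> f i = 0.
  move=> iN; have [/fN0 //|/int_geP[p ip]] := ltP i N0.
  apply: contrapT => /eqP; rewrite ip => /nmin; rewrite /N in iN; lia.
pose a p := f (N + p%:Z).
pose b (m : int) : k := if m < - N then 0
  else let p := absz (m + N) in (inv_coefs a p.+1)`_p.
have bP : exists M, forall m, m < M -> b m = 0.
  by exists (- N) => m; rewrite /b => ->.
have bN i : i < - N -> Laurent bP i = 0 by rewrite /= /b => ->.
exists (Laurent bP); apply: laurent_ext => m.
rewrite -[LHS]/(conv (Laurent bP) f m) -[RHS]/((m == 0)%:R).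
have [mlt|] := ltP m (- N + N).
  by rewrite (conv0 bN fN) // lt_eqF //; lia.
move=> /int_geP[p ->]; rewrite (convE p bN fN) addNr add0r.
have a0 : a 0%N != 0 by rewrite /a addr0.
rewrite -[RHS](inv_coefs_sum p a0).
apply: eq_bigr => j _; rewrite /= /b ifN; last by lia.
by have -> : absz (- N + j%:Z + N) = j by lia.
Qed.

Definition linv f : laurent k :=
  if pselect (exists g, g * f = 1) is left ex then projT1 (cid ex) else 0.

Lemma lmulVf f : f != 0 -> linv f * f = 1.
Proof.
move=> /lmul_inv_ex ex; rewrite /linv; case: pselect => // ex'.
by case: (cid ex').
Qed.

Lemma linv0 : linv 0 = 0.
Proof.
rewrite /linv; case: pselect => // ex; exfalso; case: ex => g.
by rewrite mulr0 => /esym/eqP; rewrite oner_eq0.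
Qed.

HB.instance Definition _ := GRing.ComNzRing_isField.Build (laurent k)
  lmulVf linv0.

Lemma lcoef0 m : (0 : laurent k) m = 0. Proof. by []. Qed.
Lemma lcoef1 m : (1 : laurent k) m = (m == 0)%:R. Proof. by []. Qed.
Lemma lcoefN f m : (- f) m = - f m. Proof. by []. Qed.
Lemma lcoefD f g m : (f + g) m = f m + g m. Proof. by []. Qed.
Lemma lcoefM f g m : (f * g) m = \sum_(i \in [set: int]) f i * g (m - i).
Proof. by []. Qed.

(** [k[[t]]], realized as a subring of [k((t))]. *)
Definition power_series : set (laurent k) :=
  [set f | forall m, m < 0 -> f m = 0].

Lemma power_series1 : power_series 1.
Proof. by move=> m m0; rewrite lcoef1 lt_eqF. Qed.

Lemma power_seriesB f g :
  power_series f -> power_series g -> power_series (f - g).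
Proof. by move=> f0 g0 m m0; rewrite lcoefD lcoefN f0 ?g0 ?subr0. Qed.

Lemma power_seriesM f g :
  power_series f -> power_series g -> power_series (f * g).
Proof. by move=> f0 g0 m m0; rewrite lcoefM -/(conv f g m) (conv0 f0 g0). Qed.

End LaurentField.

Section PowerSeriesModules.
Variables (k : fieldType) (V : vectType (laurent k)).
Implicit Types (M : set V) (x y : V) (a c : laurent k).

Definition is_Osubmodule M : Prop :=
  [/\ M 0,
      forall x y, M x -> M y -> M (x + y) &
      forall c x, power_series c -> M x -> M (c *: x)].

Definition divisible_part M : set V :=
  [set x | M x /\ forall a, M (a *: x)].

Definition O_span (s : seq V) : set V :=
  [set x | exists c : 'I_(size s) -> laurent k,
    (forall i, power_series (c i)) /\ x = \sum_(i < size s) c i *: s`_i].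

Definition finitely_generated_Omodule M : Prop := exists s : seq V, M = O_span s.

End PowerSeriesModules.

(* Main.v *)
Require Import Defs.
From mathcomp Require Import all_boot all_order all_algebra.
From mathcomp Require Import zify.
From mathcomp Require Import boolp classical_sets fsbigop.

Import Order.TTheory GRing.Theory.
Local Open Scope classical_set_scope.
Local Open Scope ring_scope.

(** Write [A = k((t))] and [O = k[[t]]]. The proof shows, by induction on a list
    [X] of vectors, that [M] meets the span of [X] in a finitely generated
    [O]-module. To pass from [X] to [v :: X] with [v] outside the span [U] of
    [X], look at the set [I] of all [a] in [A] such that [a v + w] lies in [M]
    for some [w] in [U]; it is an [O]-submodule of [A].

    If [I] misses some power [t^(-n)], the valuation is bounded below on [I],
    so [I] is principal ([proper_Osubmodule_principal]); lifting a generator of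
    [I] to [M] gives the one generator to be added to those of the intersection
    of [M] with [U].

    If [I] contains every [t^(-n)], lift these to [x_n] in [M]. The errors
    [d_n = t x_(n+1) - x_n] lie in the intersection of [M] with [U], which is
    finitely generated and hence [t]-adically complete: there are [e_n] in it
    with [e_n = d_n + t e_(n+1)] ([O_span_complete]). Then [y_n = x_n + e_n] is
    in [M] and satisfies [t y_(n+1) = y_n] exactly, so that all the vectors
    [t^(-n) y_0] are in [M] and [y_0] is divisible. As [y_0] is in [v + U], it
    is nonzero, against the hypothesis on the divisible part. *)

(** * Valuations of Laurent series *)

Section LaurentSeries.
Variable k : fieldType.
Implicit Types (f g c : laurent k) (I : set (laurent k)).

Lemma uniformizer_subproof :
  exists N : int, forall m, m < N -> (m == 1)%:R = 0 :> k.
Proof. by exists 0 => m m0; rewrite lt_eqF //; lia. Qed.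

Definition uniformizer : laurent k := Laurent uniformizer_subproof.
Local Notation t := uniformizer.

Lemma lcoef_uniformizerM f (m : int) : (t * f) m = f (m - 1).
Proof.
rewrite lcoefM (fsbigE [:: 1]) //.
- by rewrite big_cons big_nil in_setT /= mul1r addr0.
- by move=> i _; rewrite inE => /= /negPf ->; rewrite mul0r.
Qed.

Lemma lcoef_uniformizerXM n f (m : int) : (t ^+ n * f) m = f (m - n%:Z).
Proof.
elim: n m => [|n IHn] m; first by rewrite mul1r subr0.
by rewrite exprS -mulrA lcoef_uniformizerM IHn; congr (lcoef _ _); lia.
Qed.

Lemma uniformizer_neq0 : t != 0.
Proof.
by apply/eqP => /(congr1 (fun f => lcoef f 1))/eqP; rewrite /= oner_eq0.
Qed.

Lemma power_series_uniformizer : power_series t.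
Proof. by move=> m m0 /=; rewrite lt_eqF //; lia. Qed.

Lemma power_series0 : power_series (0 : laurent k).
Proof. by []. Qed.

Lemma power_seriesN f : power_series f -> power_series (- f).
Proof. by move=> fO; rewrite -sub0r; apply: power_seriesB. Qed.

Lemma uniformizerX_power_series f : exists n, power_series (t ^+ n * f).
Proof.
have [N fN] := lcoefP f; exists `|N|%N => m m0.
by rewrite lcoef_uniformizerXM fN //; lia.
Qed.

Lemma laurent_neq0_coef f : f != 0 -> exists m, f m != 0.
Proof.
move=> f0; apply: contrapT => nf; move/eqP: f0; apply.
apply: laurent_ext => m; rewrite lcoef0.
by apply: contrapT => /eqP fm; apply: nf; exists m.
Qed.

(** The nonzero coefficients of all members of [I] together have a first
    index as soon as they have a lower bound: [I] may be a single series or a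
    bounded family. *)
Lemma least_order I (N : int) :
    (forall f, I f -> forall m, m < N -> f m = 0) ->
    (exists2 f, I f & f != 0) ->
  exists L : int, (exists2 f, I f & f L != 0) /\
    (forall f, I f -> forall m, m < L -> f m = 0).
Proof.
move=> IN [f If /laurent_neq0_coef[m fm]].
pose P n := `[< exists2 g, I g & g (N + n%:Z) != 0 >].
have exP : exists n, P n.
  have [/(IN f If)/eqP|/int_geP[n mn]] := ltP m N; first by rewrite (negPf fm).
  by exists n; apply/asboolP; exists f; rewrite // -mn.
have [n /asboolP Pn nmin] := ex_minnP exP; exists (N + n%:Z); split=> // g Ig i.
have [/(IN g Ig) //|/int_geP[p ->] pn] := ltP i N.
apply: contrapT => /eqP gi; have /nmin : P p by apply/asboolP; exists g.
by lia.
Qed.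

Lemma laurent_order f : f != 0 ->
  exists L : int, f L != 0 /\ forall m, m < L -> f m = 0.
Proof.
move=> f0; have [N fN] := lcoefP f.
have [||L [[g -> gL] LP]] := @least_order [set f] N.
- by move=> g ->.
- by exists f.
by exists L; split=> //; apply: LP.
Qed.

(** The leading coefficients of [g / f] and [f] multiply to a coefficient of
    [g], so the order of [g / f] cannot be negative. *)
Lemma power_series_div f g (N : int) :
    f N != 0 -> (forall m, m < N -> f m = 0) ->
    (forall m, m < N -> g m = 0) ->
  power_series (g / f).
Proof.
move=> fN f_lt g_lt; set h := g / f.
have f0 : f != 0 by apply: contra fN => /eqP ->.
have [->|h0] := eqVneq h 0; first exact: power_series0.
have [L [hL h_lt]] := laurent_order h h0.
suff L0 : 0 <= L by move=> m m0; apply: h_lt; exact: lt_le_trans m0 L0.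
rewrite leNgt; apply/negP => Llt0.
have: g (L + N + 0%:Z) = 0 by apply: g_lt; lia.
have -> : g = h * f by rewrite /h divfK.
rewrite -[LHS]/(conv h f _) (convE 0 h_lt f_lt) big_ord1 !addr0.
by move/eqP; rewrite mulf_eq0 (negPf hL) (negPf fN).
Qed.

(** A submodule that misses [t^(-n)] contains no nonzero element of order at
    most [-n], since [t^(-n)] is a multiple of such an element by a power
    series; an element of least order then generates it. *)
Lemma proper_Osubmodule_principal I n :
    I 0 -> (forall c f, power_series c -> I f -> I (c * f)) ->
    ~ I (t^-1 ^+ n) ->
  exists2 f, I f & forall g, I g -> exists2 c, power_series c & g = c * f.
Proof.
move=> I0 IM nI.
have [[f If f0]|noI] := pselect (exists2 f, I f & f != 0); last first.
  exists 0 => // g Ig; exists 0; first exact: power_series0.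
  rewrite mulr0; apply: contrapT => /eqP g0; apply: noI; by exists g.
have tn_lt (m : int) : m < - n%:Z -> (t^-1 ^+ n) m = 0.
  move=> mn; have := lcoef_uniformizerXM n (t^-1 ^+ n) (m + n%:Z).
  rewrite addrK => <-; rewrite exprVn mulfV ?expf_neq0 ?uniformizer_neq0 //.
  by rewrite lcoef1 lt_eqF //; lia.
have I_lt g : I g -> forall m : int, m < - n%:Z -> g m = 0.
  move=> Ig m mn; apply: contrapT => /eqP gm; apply: nI.
  have g0 : g != 0 by apply: contra gm => /eqP ->.
  have [L [gL g_lt]] := laurent_order g g0.
  have Lm : L <= m by rewrite leNgt; apply: contra gm => /g_lt ->.
  rewrite -(divfK g0 (t^-1 ^+ n)); apply: IM => //.
  apply: (@power_series_div _ _ L) => // i iL; apply: tn_lt; lia.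
have [|L [[g Ig gL] L_lt]] := least_order I _ I_lt; first by exists f.
exists g => // h Ih; exists (h / g).
  by apply: (@power_series_div _ _ L) => //; apply: L_lt.
by rewrite divfK //; apply: contra gL => /eqP ->.
Qed.

(** * Completeness *)

(** Coefficients of the series [c n + t * c n.+1 + t^2 * c n.+2 + ...].
    When the [c i] are power series, only the terms up to [t ^ m * c (n + m)]
    reach the coefficient at [t ^ m]. *)
Definition tail_coef (c : nat -> laurent k) n (m : int) : k :=
  if m < 0 then 0 else \sum_(j < `|m|%N.+1) c (n + j)%N (m - j%:Z).

Lemma tail_subproof (c : nat -> laurent k) n :
  exists N : int, forall m, m < N -> tail_coef c n m = 0.
Proof. by exists 0 => m m0; rewrite /tail_coef m0. Qed.

Definition tail (c : nat -> laurent k) n : laurent k :=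
  Laurent (tail_subproof c n).

Lemma power_series_tail (c : nat -> laurent k) n : power_series (tail c n).
Proof. by move=> m m0 /=; rewrite /tail_coef m0. Qed.

Lemma tailE (c : nat -> laurent k) n : (forall i, power_series (c i)) ->
  tail c n = c n + t * tail c n.+1.
Proof.
move=> cO; apply: laurent_ext => m; rewrite lcoefD lcoef_uniformizerM /=.
rewrite /tail_coef; have [m0|] := ltP m 0.
  have m1 : m - 1 < 0 by lia.
  by rewrite cO // m1 addr0.
move=> /int_geP[p]; rewrite add0r => ->.
rewrite big_ord_recl addn0 subr0; congr (_ + _).
case: p => [|p]; first by rewrite big_ord0.
have -> : (p.+1%:Z - 1 < 0) = false by lia.
have -> : `|p.+1%:Z - 1|%N.+1 = `|p.+1%:Z|%N by lia.
apply: eq_bigr => i _; rewrite lift0 addnS addSn.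
by congr (lcoef _ _); lia.
Qed.

End LaurentSeries.

Arguments uniformizer {k}.
Local Notation t := uniformizer.

Section Modules.
Variables (k : fieldType) (V : vectType (laurent k)).
Implicit Types (M : set V) (x y v : V) (s X : seq V) (U : {vspace V}).

(** Summing [t^j d_(n+j)] over [j] amounts to summing the coefficients of the
    [d_i] on the finitely many generators. *)
Lemma O_span_complete s (d : nat -> V) : (forall n, O_span s (d n)) ->
  exists2 e : nat -> V, forall n, O_span s (e n) &
    forall n, e n = d n + t *: e n.+1.
Proof.
move=> /choice[c cP]; pose b i n := c n i.
exists (fun n => \sum_(i < size s) tail k (b i) n *: s`_i) => n.
  by exists (fun i => tail k (b i) n); split=> // i; apply: power_series_tail.
have [_ ->] := cP n; rewrite scaler_sumr -big_split /=; apply: eq_bigr => i _.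
by rewrite scalerA -scalerDl -tailE // => j; apply: (proj1 (cP j)).
Qed.

Lemma O_span_cons x s y : O_span (x :: s) y <->
  exists c, power_series c /\ O_span s (y - c *: x).
Proof.
split=> [[c [cO ->]]|[c [cO [b [bO yE]]]]].
  exists (c ord0); split=> //; exists (fun i => c (lift ord0 i)); split=> //.
  by rewrite big_ord_recl /= addrAC subrr add0r.
exists (fun i => if unlift ord0 i is Some j then b j else c); split.
  by move=> i; case: unliftP.
rewrite big_ord_recl unlift_none /= -[y in LHS](subrK (c *: x)) yE addrC.
by congr (_ + _); apply: eq_bigr => i _; rewrite liftK.
Qed.

(** * Intersections with a growing subspace *)

Section Submodule.
Variables (M : set V) (hM : is_Osubmodule M).

Let M0 : M 0. Proof. by case: hM. Qed.
Let MD x y : M x -> M y -> M (x + y). Proof. by case: hM => _ + _; apply. Qed.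
Let MZ c x : power_series c -> M x -> M (c *: x).
Proof. by case: hM => _ _; apply. Qed.
Let MB x y : M x -> M y -> M (x - y).
Proof.
move=> Mx My; rewrite -scaleN1r; apply/MD => //; apply: MZ => //.
exact/power_seriesN/power_series1.
Qed.

Definition meetv U : set V := [set x | M x /\ x \in U].

(** Every [a] is [t^(-n)] times a power series for some [n], so that
    divisibility by the powers of [t] is enough. *)
Lemma divisible_partP (y : nat -> V) :
  (forall n, M (y n)) -> (forall n, y n = t *: y n.+1) ->
  divisible_part M (y 0).
Proof.
move=> My yS; split=> // a; have [n anO] := uniformizerX_power_series k a.
suff -> : y 0 = t ^+ n *: y n by rewrite scalerA mulrC; apply: MZ.
elim: n {anO} => [|n IHn]; first by rewrite scale1r.
by rewrite IHn [y n]yS scalerA exprSr.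
Qed.

(** For [v] outside [U], the image of [meetv (<[v]> + U)] under the linear
    form that vanishes on [U] and takes the value [1] at [v]. *)
Definition leading_coefs U v : set (laurent k) :=
  [set a | exists2 w, w \in U & M (a *: v + w)].

(** Correcting the lifts of the [t^(-n)] by elements of the complete module
    [meetv U] turns them into a sequence that is exactly compatible under
    multiplication by [t]; the coefficient of [v] is unaffected, which keeps the
    first vector of the new sequence away from zero. *)
Lemma leading_coefs_all_divisible U v s : v \notin U ->
    meetv U = O_span s -> (forall n, leading_coefs U v (t^-1 ^+ n)) ->
  exists2 y, divisible_part M y & y != 0.
Proof.
move=> vU Us coefs; have /choice[w wP] n :
    exists w, w \in U /\ M (t^-1 ^+ n *: v + w).
  by have [w wU wM] := coefs n; exists w.
have wU n : w n \in U by have [] := wP n.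
pose x n := t^-1 ^+ n *: v + w n; have xM n : M (x n) by have [] := wP n.
pose d n := t *: x n.+1 - x n.
have dE n : d n = t *: w n.+1 - w n.
  rewrite /d /x scalerDr scalerA exprS mulrA mulfV ?uniformizer_neq0 // mul1r.
  by rewrite opprD addrACA subrr add0r.
have ds n : O_span s (d n).
  rewrite -Us; split; last by rewrite dE rpredB // rpredZ.
  by apply: MB => //; apply: MZ => //; apply: power_series_uniformizer.
have [e es eE] := O_span_complete s d ds.
have eP n : meetv U (e n) by rewrite Us.
exists (x 0 + e 0).
  apply: (@divisible_partP (fun n => x n + e n)) => n.
    by have [? _] := eP n; apply: MD.
  by rewrite (scalerDr _ (x n.+1)) eE addrA; congr (_ + _); rewrite addrC subrK.
(* If [y_0 = v + w 0 + e 0] vanished, [v] would be in [U]. *)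
apply: contra vU; rewrite /x expr0 scale1r -addrA addr_eq0 => /eqP ->.
by have [_ ?] := eP 0; rewrite rpredN rpredD.
Qed.

(** With [a] a generator of the leading coefficients, a lift [a v + w] of it to
    [M] allows [v] to be eliminated from any member of the intersection, with a
    multiplier in [k[[t]]]. *)
Lemma meetv_addv_fg U v s n : meetv U = O_span s ->
    ~ leading_coefs U v (t^-1 ^+ n) ->
  finitely_generated_Omodule (meetv (<[v]> + U)).
Proof.
move=> Us nI.
have [||a [w wU aM] aP] :=
    @proper_Osubmodule_principal k (leading_coefs U v) n _ _ nI.
- by exists 0; rewrite ?mem0v // scale0r addr0.
- move=> c f cO [w wU fM]; exists (c *: w); first by rewrite rpredZ.
  by rewrite -scalerA -scalerDr; apply: MZ.
exists (a *: v + w :: s); apply/seteqP; split=> y; rewrite O_span_cons -Us.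
  move=> [My /memv_addP[_ /vlineP[b ->] [u uU yE]]].
  have [|c cO bE] := aP b; first by exists u; rewrite // -yE.
  exists c; split=> //; split; first by apply: MB => //; apply: MZ.
  rewrite yE bE scalerDr scalerA opprD addrACA subrr add0r.
  by rewrite rpredB // rpredZ.
move=> [c [cO [yM yU]]]; rewrite -[y](subrK (c *: (a *: v + w))); split.
  by apply: MD => //; apply: MZ.
rewrite rpredD //; first by rewrite (subvP (addvSr _ _)).
by rewrite rpredZ // memv_add // rpredZ // memv_line.
Qed.

Lemma meetv_span_fg X : divisible_part M = [set 0] ->
  finitely_generated_Omodule (meetv <<X>>).
Proof.
move=> hdiv; elim: X => [|v X [s Xs]].
  exists [::]; apply/seteqP; split=> y.
    rewrite span_nil => -[_]; rewrite memv0 => /eqP ->.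
    by exists (fun=> 0); rewrite big_ord0.
  by move=> [c [_ ->]]; rewrite big_ord0; split; rewrite ?mem0v.
rewrite span_cons; have [vX|vX] := boolP (v \in <<X>>%VS).
  by exists s; rewrite -Xs; congr meetv; apply/addv_idPr; rewrite -memvE.
have [n nI] : exists n, ~ leading_coefs <<X>> v (t^-1 ^+ n).
  apply: contrapT => /forallNP Iall.
  have [n|y] := @leading_coefs_all_divisible <<X>> v s vX Xs.
    by apply: contrapT; apply: Iall.
  by rewrite hdiv => -> /eqP.
exact: meetv_addv_fg Xs nI.
Qed.

End Submodule.
End Modules.

Theorem theorem3p5 (k : fieldType) (V : vectType (laurent k)) (M : set V)
    (hM : is_Osubmodule M) (hdiv : divisible_part M = [set 0]) :
  finitely_generated_Omodule M.
Proof.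
have [s sE] := meetv_span_fg k V M hM (vbasis fullv) hdiv.
exists s; rewrite -sE (span_basis (vbasisP _)).
by apply/seteqP; split=> [x Mx|x []]; rewrite // /meetv /= memvf.
Qed.
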